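(* Let $n\ge2$, $m\ge2$ be integers with $m\ge\sqrt n$, let $B_1,\ldots,B_m$ be mutually unbiased orthonormal bases of $\mathbb{C}^n$, and let $\mathfrak{B}=\bigsqcup_{i=1}^m B_i$. Let $p$ be a positive integer with $y=\frac pn\in(0,1)$. Let $\Omega_p$ be the set of all maps $s:\{1,\ldots,p\}\to\mathfrak{B}$ with the uniform probability, and for $s\in\Omega_p$ let $\mathcal{G}(s)$ be the $p\times p$ matrix with $(i,j)$-entry $\langle s(i),s(j)\rangle$. For a positive integer $l$ set $A_l(s)=\frac1p\mathrm{Tr}\big(\mathcal{G}(s)^l\big)$. Then for every fixed positive integer $l$, $$\mathrm{Var}\big(A_l(s),\Omega_p\big)=O_l\!\left(\frac{1}{mn}+\frac1{n^2}\right),$$ where the implied constant depends only on $l$.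
   Context: Orthonormal bases $B_1,\ldots,B_m$ of $\mathbb{C}^n$ are mutually unbiased if $|\langle u,v\rangle|=\frac{1}{\sqrt n}$ for all $u\in B_i$, $v\in B_j$, $i\ne j$, where $\langle\cdot,\cdot\rangle$ is the standard Hermitian inner product. $\mathrm{Var}(X,\Omega_p)=\mathbb{E}(|X|^2,\Omega_p)-|\mathbb{E}(X,\Omega_p)|^2$, with expectation taken with respect to the uniform probability on $\Omega_p$. *)

(* Defs.v *)
From HB Require Import structures.
From mathcomp Require Import all_boot all_order all_algebra.
From mathcomp Require Import complex.
From mathcomp Require Import reals.
Set Implicit Arguments. Unset Strict Implicit. Unset Printing Implicit Defensive.
Import Order.TTheory GRing.Theory Num.Theory.
Local Open Scope ring_scope.

Definition hdot (C : numClosedFieldType) (n : nat) (u v : 'rV[C]_n) : C :=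
  \sum_(k < n) u 0 k * (v 0 k)^*.

Definition orthonormal_basis (C : numClosedFieldType) (n : nat)
    (b : 'I_n -> 'rV[C]_n) : Prop :=
  forall k k' : 'I_n, hdot (b k) (b k') = (k == k')%:R.

Definition mutually_unbiased (C : numClosedFieldType) (n m : nat)
    (B : 'I_m -> 'I_n -> 'rV[C]_n) : Prop :=
  (forall i, orthonormal_basis (B i)) /\
  (forall (i j : 'I_m) (u v : 'I_n), i != j ->
      `|hdot (B i u) (B j v)| = (sqrtC (n%:R : C))^-1).

(* Omega_p: maps s : {1..p} -> frakB, where frakB = disjoint union of the
   B_i, indexed by pairs (i, k) : 'I_m * 'I_n. *)
Definition Omega (n m p : nat) := {ffun 'I_p -> 'I_m * 'I_n}.

Definition gram (C : numClosedFieldType) (n m p : nat)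
    (B : 'I_m -> 'I_n -> 'rV[C]_n) (s : Omega n m p) : 'M[C]_p :=
  \matrix_(i < p, j < p) hdot (B (s i).1 (s i).2) (B (s j).1 (s j).2).

Definition A_l (C : numClosedFieldType) (n m p l : nat)
    (B : 'I_m -> 'I_n -> 'rV[C]_n) (s : Omega n m p) : C :=
  (p%:R)^-1 * \tr ((gram B s) ^+ l).

Definition Exp (C : numClosedFieldType) (n m p : nat) (X : Omega n m p -> C) : C :=
  (#|{: Omega n m p}|%:R)^-1 * \sum_(s : Omega n m p) X s.

Definition Var (C : numClosedFieldType) (n m p : nat) (X : Omega n m p -> C) : C :=
  Exp (fun s => `|X s| ^+ 2) - `|Exp X| ^+ 2.

(* Main.v *)
(* With M = sum_i u_i^* u_i over the sample, p A_l = tr M^l.  By the Efron-Stein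
   inequality it is enough to bound the variance of tr (N + u^* u)^l in one fresh
   uniform point u, the sum N of the other ones being frozen.  Now
   tr (N + u^* u)^l - tr N^l is a polynomial in the moments q_k(u) = u N^k u^*.
   The traceless parts of the rank one projections of distinct mutually unbiased
   bases are orthogonal, so Bessel's inequality bounds the variance of each q_k by
   tr N^(2k) / (m n).  Submultiplicativity q_a q_b <= q_(a+b) of moment sequences
   reduces polynomials in the q_k to this case, and also gives
   E tr M^l = O_l(p) by induction on l.  The outcome is Var A_l = O_l(1 / (m n)). *)
Require Import Defs.
From HB Require Import structures.
From mathcomp Require Import all_boot all_order all_algebra.
From mathcomp Require Import complex.
From mathcomp Require Import reals.
From mathcomp Require Import zify ring lra.
Import Order.TTheory GRing.Theory Num.Theory.
Local Open Scope ring_scope.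

Set Implicit Arguments. Unset Strict Implicit. Unset Printing Implicit Defensive.

(** * Moment sequences and functions of polynomial growth in them *)

Section MomentSequences.
Variable R : realFieldType.
Implicit Types q t : nat -> R.

(* The Hankel condition is that of the moments of a probability measure on
   [0, +oo[, tested on polynomials X^k (u + v X)^2 only; being linear in q, it is
   stable under averaging. *)
Definition moment_seq q : Prop :=
  q 0 = 1 /\
  forall k u v, 0 <= u ^+ 2 * q k + 2 * u * v * q k.+1 + v ^+ 2 * q k.+2.

Lemma moment_ge0 q k : moment_seq q -> 0 <= q k.
Proof. by case=> _ /(_ k 1 0); rewrite expr1n expr0n /=; lra. Qed.

Lemma moment_log_convex q k :
  moment_seq q -> q k.+1 ^+ 2 <= q k * q k.+2.
Proof.
move=> Hq; have [_ H] := Hq; have q0 := moment_ge0 k Hq.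
(* The pair ([q k.+1], [- q k]) yields [q k] times the claim; when [q k = 0], the other pair forces
   [q k.+1 = 0]. *)
have := H k (q k.+1) (- q k); have := H k (- (q k.+2 + 1)) (q k.+1).
case: (eqVneq (q k) 0) => [-> h _|qk _ h].
  have := moment_ge0 k.+2 Hq => h2.
  nra.
have {}q0 : 0 < q k by rewrite lt_def qk.
rewrite -(ler_pM2l q0); nra.
Qed.

(** Log-convexity makes the ratios [q k.+1 / q k] nondecreasing; the cross-multiplied form covers
    vanishing moments as well. *)
Lemma moment_ratio q a b : moment_seq q -> (b <= a)%N ->
  q a * q b.+1 <= q a.+1 * q b.
Proof.
move=> Hq; elim: a => [|a IH]; first by rewrite leqn0 => /eqP ->; rewrite mulrC.
rewrite leq_eqVlt => /orP[/eqP -> |]; first by rewrite mulrC.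
rewrite ltnS => /IH {}IH; have h := moment_log_convex a Hq.
have [q0 q1 q2] := And3 (moment_ge0 a Hq) (moment_ge0 a.+1 Hq) (moment_ge0 a.+2 Hq).
have [b0 b1] := conj (moment_ge0 b Hq) (moment_ge0 b.+1 Hq).
case: (eqVneq (q a) 0) => [qa0|qa].
  have -> : q a.+1 = 0.
    by apply/eqP; rewrite -sqrf_eq0 eq_le sqr_ge0 andbT -(mul0r (q a.+2)) -qa0.
  by rewrite mul0r mulr_ge0.
have {}q0 : 0 < q a by rewrite lt_def qa.
rewrite -(ler_pM2l q0).
have := ler_wpM2l q1 IH; have := ler_wpM2r b0 h.
nra.
Qed.

(** By [moment_ratio], units of exponent move from the smaller index to the larger one without
    decreasing the product, until the factor [q 0 = 1] is left. *)
Lemma moment_submul q a b : moment_seq q -> q a * q b <= q (a + b)%N.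
Proof.
move=> Hq; wlog lba : a b / (b <= a)%N => [H|].
  case/orP: (leq_total b a) => [/H //|/H]; by rewrite mulrC addnC.
elim: b a lba => [|b IH] a lba; first by case: Hq => -> _; rewrite mulr1 addn0.
apply: le_trans (moment_ratio Hq (ltnW lba)) _.
by rewrite addnS -addSn; apply: IH; lia.
Qed.

(** Testing on X^k (1 - X)^2 shows convexity in the exponent, whence [q k <= 1 + q k.+1] by
    induction; each unit of exponent costs 1. *)
Lemma moment_mono q a b : moment_seq q -> (a <= b)%N -> q a <= b%:R + q b.
Proof.
move=> Hq; elim: b => [|b IH]; first by rewrite leqn0 => /eqP ->; lra.
rewrite leq_eqVlt => /orP[/eqP ->|]; first by rewrite lerDr.
rewrite ltnS => /IH /le_trans; apply.
rewrite -natr1 -addrA lerD2l {IH a}.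
elim: b => [|b IH]; first by have := moment_ge0 1 Hq; case: Hq => -> _; lra.
by have [_ /(_ b 1 (-1))] := Hq; nra.
Qed.

(** Bounds applied to the midpoint of two sequences control mixed products such as [q d * t d']. *)
Lemma moment_halfD q t : moment_seq q -> moment_seq t ->
  moment_seq (fun k => (q k + t k) / 2).
Proof.
move=> [q0 Hq] [t0 Ht]; split=> [|k u v]; first by rewrite q0 t0; lra.
have := Hq k u v; have := Ht k u v; lra.
Qed.

Definition seq_dist d q t : R := \sum_(k < d.+1) `|q k - t k|.

Lemma seq_dist_ge0 d q t : 0 <= seq_dist d q t.
Proof. by rewrite sumr_ge0. Qed.

Lemma seq_dist_le d d' q t : (d <= d')%N -> seq_dist d q t <= seq_dist d' q t.
Proof.
move=> dd'; rewrite /seq_dist (big_ord_widen d'.+1 (fun k => `|q k - t k|)) //.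
rewrite big_mkcond /=; apply: ler_sum => k _; by case: ifP.
Qed.

(* F behaves like a polynomial of weighted degree d when q k has weight k. *)
Definition tame d (F : (nat -> R) -> R) : Prop :=
  exists2 C, 0 <= C & forall q t, moment_seq q -> moment_seq t ->
    `|F q| <= C * (1 + q d) /\
    `|F q - F t| <= C * (1 + q d + t d) * seq_dist d q t.

Lemma tame_coord k : tame k (fun q => q k).
Proof.
exists 1 => // q t Hq Ht; have [q0 t0] := conj (moment_ge0 k Hq) (moment_ge0 k Ht).
split; first by rewrite ger0_norm //; lra.
have : `|q k - t k| <= seq_dist k q t.
  by rewrite /seq_dist big_ord_recr /= lerDr sumr_ge0.
have := normr_ge0 (q k - t k); nra.
Qed.

Lemma tameD d F G : tame d F -> tame d G -> tame d (fun q => F q + G q).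
Proof.
move=> [C C0 HF] [C' C'0 HG]; exists (C + C'); first exact: addr_ge0.
move=> q t Hq Ht; have [f1 f2] := HF q t Hq Ht; have [g1 g2] := HG q t Hq Ht.
split.
  by apply: le_trans (ler_normD _ _) _; rewrite mulrDl lerD.
rewrite opprD addrACA.
by apply: le_trans (ler_normD _ _) _; rewrite 2!mulrDl lerD.
Qed.

Lemma tame_leq d d' F : (d <= d')%N -> tame d F -> tame d' F.
Proof.
move=> dd' [C C0 HF]; exists (C * (1 + 2 * d'%:R)).
  by rewrite mulr_ge0 // addr_ge0 // mulr_ge0 // ler0n.
move=> q t Hq Ht; have [f1 f2] := HF q t Hq Ht.
have hq := moment_mono Hq dd'; have ht := moment_mono Ht dd'.
have [q0 t0] := conj (moment_ge0 d' Hq) (moment_ge0 d' Ht).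
have n0 : 0 <= d'%:R :> R by rewrite ler0n.
split; [apply: le_trans f1 _|apply: le_trans f2 _]; rewrite -!mulrA ler_wpM2l //.
  by nra.
rewrite mulrA; apply: ler_pM; rewrite ?seq_dist_ge0 ?seq_dist_le //.
  by have := moment_ge0 d Hq; have := moment_ge0 d Ht; lra.
nra.
Qed.

Lemma tame_sum n d (F : 'I_n -> (nat -> R) -> R) :
  (forall i, tame d (F i)) -> tame d (fun q => \sum_i F i q).
Proof.
elim: n F => [|n IH] F tF.
  exists 0 => // q t _ _; rewrite !big_ord0 subrr normr0.
  by rewrite !mul0r.
have [C C0 H] := tameD (tF ord0) (IH _ (fun i => tF (lift ord0 i))).
by exists C => // q t Hq Ht; rewrite !big_ord_recl; apply: H.
Qed.

Lemma tameM d d' F G : tame d F -> tame d' G -> tame (d + d') (fun q => F q * G q).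
Proof.
move=> [C C0 HF] [C' C'0 HG].
(* [K] comes from expanding the product below, where [q d] and [q d'] are at most
   [(d + d')%:R + q (d + d')] and their product is at most [q (d + d')]. *)
pose K : R := 5 + 4 * (d + d')%:R; have n0 : 0 <= (d + d')%:R :> R by rewrite ler0n.
have prod_le q : moment_seq q ->
    (1 + 2 * q d) * (1 + 2 * q d') <= K * (1 + 2 * q (d + d')%N).
  move=> Hq; have h1 := moment_mono Hq (leq_addr d' d).
  have h2 := moment_mono Hq (leq_addl d d'); have h3 := moment_submul d d' Hq.
  have := moment_ge0 (d + d') Hq; rewrite /K; nra.
have K0 : 0 <= K by rewrite /K; lra.
exists (2 * (C * C' * K)); first by rewrite !mulr_ge0.
move=> q t Hq Ht; have [f1 f2] := HF q t Hq Ht; have [g1 g2] := HG q t Hq Ht.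
have [f3 _] := HF t q Ht Hq.
have Hr := moment_halfD Hq Ht.
have [q0 q1 q2] := And3 (moment_ge0 d Hq) (moment_ge0 d' Hq) (moment_ge0 (d + d') Hq).
have [t0 t1 t2] := And3 (moment_ge0 d Ht) (moment_ge0 d' Ht) (moment_ge0 (d + d') Ht).
have CC : 0 <= C * C' by rewrite mulr_ge0.
split.
  rewrite normrM; apply: le_trans (ler_pM _ _ f1 g1) _ => //.
  rewrite mulrACA.
  have -> : 2 * (C * C' * K) * (1 + q (d + d')%N)
    = C * C' * (K * (2 * (1 + q (d + d')%N))) by ring.
  rewrite ler_wpM2l //; have := prod_le q Hq; have := mulr_ge0 q0 q1; nra.
have -> : F q * G q - F t * G t = (F q - F t) * G q + F t * (G q - G t) by ring.
apply: le_trans (ler_normD _ _) _; rewrite !normrM.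
have D1 := seq_dist_le q t (leq_addr d' d); have D2 := seq_dist_le q t (leq_addl d d').
have D10 := seq_dist_ge0 d q t; have D20 := seq_dist_ge0 d' q t.
set D := seq_dist (d + d') q t in D1 D2 *.
have D0 : 0 <= D by exact: seq_dist_ge0.
(* At the midpoint r of q and t one has 1 + 2 r_d = 1 + q_d + t_d, so [X] dominates both mixed
   products. *)
have := prod_le _ Hr => /=.
set X := (1 + 2 * _) * _; set Y := (1 + 2 * _) => hX.
have hX1 : (1 + q d + t d) * (1 + q d') <= X by rewrite /X; nra.
have hX2 : (1 + t d) * (1 + q d' + t d') <= X by rewrite /X; nra.
have -> : 2 * (C * C' * K) * (1 + q (d + d')%N + t (d + d')%N) * D
   = C * C' * (K * Y) * D + C * C' * (K * Y) * D by rewrite /Y; field.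
apply: lerD.
  apply: (le_trans (ler_pM (normr_ge0 _) (normr_ge0 _) f2 g1)).
  have -> : C * (1 + q d + t d) * seq_dist d q t * (C' * (1 + q d'))
    = C * C' * ((1 + q d + t d) * (1 + q d')) * seq_dist d q t by ring.
  apply: ler_pM => //; first by rewrite !mulr_ge0 //; lra.
  by rewrite ler_wpM2l // (le_trans hX1).
apply: (le_trans (ler_pM (normr_ge0 _) (normr_ge0 _) f3 g2)).
have -> : C * (1 + t d) * (C' * (1 + q d' + t d') * seq_dist d' q t)
  = C * C' * ((1 + t d) * (1 + q d' + t d')) * seq_dist d' q t by ring.
apply: ler_pM => //; first by rewrite !mulr_ge0 //; lra.
by rewrite ler_wpM2l // (le_trans hX2).
Qed.

Lemma sqr_sum_le n (f : 'I_n -> R) :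
  (\sum_i f i) ^+ 2 <= n%:R * \sum_i f i ^+ 2.
Proof.
elim: n f => [|n IH] f; first by rewrite !big_ord0 expr0n mul0r.
rewrite !big_ord_recl; have := IH (fun i => f (lift ord0 i)).
set s := \sum_i _; set s2 := \sum_i _; set a := f ord0; rewrite -natr1.
have n0 : 0 <= n%:R :> R by rewrite ler0n.
case: (eqVneq n 0%N) => [n00|nn]; last first.
  have {}n0 : 0 < n%:R :> R by rewrite ltr0n lt0n.
  move=> h; have h2 : 2 * a * s <= n%:R * a ^+ 2 + s2.
    rewrite -(ler_pM2l n0); have := sqr_ge0 (n%:R * a - s); nra.
  nra.
have s0 : s = 0 by rewrite /s big1 // => i _; have := ltn_ord i; rewrite {2}n00.
have -> : s2 = 0 by rewrite /s2 big1 // => i _; have := ltn_ord i; rewrite {2}n00.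
by rewrite s0 n00; nra.
Qed.

(* When q S > 2 t S + 1 the deviation q S - t S is at least half of q S, and at
   least 1/2, so its square dominates q S; this trades the unbounded factor q S
   for a square of a deviation, the only quantity that Bessel's inequality
   controls. *)
Lemma tame_sqr_le d F : tame d F -> exists C S, 0 <= C /\
  forall q t, moment_seq q -> moment_seq t ->
    (F q - F t) ^+ 2 <= C * (1 + t S) * \sum_(k < S.+1) (q k - t k) ^+ 2.
Proof.
(* With S = 2 d, submultiplicativity gives [q d ^+ 2 <= q S]. *)
move=> [C C0 HF]; pose S := (d + d)%N.
have n0 : 0 <= S%:R :> R by rewrite ler0n.
exists (C ^+ 2 * (60 + 9 * S%:R)), S; split.
  by rewrite mulr_ge0 ?sqr_ge0 //; lra.
move=> q t Hq Ht; have [f1 f2] := HF q t Hq Ht; have [f3 _] := HF t q Ht Hq.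
set D2 := \sum_(k < S.+1) _.
have D20 : 0 <= D2 by apply: sumr_ge0 => k _; exact: sqr_ge0.
have dist2 : seq_dist d q t ^+ 2 <= (1 + S%:R) * D2.
  apply: (@le_trans _ _ (seq_dist S q t ^+ 2)).
    by rewrite ler_sqr ?nnegrE ?seq_dist_ge0 // seq_dist_le // leq_addr.
  apply: le_trans (sqr_sum_le _) _; rewrite -natr1 addrC ler_wpM2l //; first lra.
  by apply: ler_sum => k _; rewrite real_normK // num_real.
have [q0 q1] := conj (moment_ge0 d Hq) (moment_ge0 S Hq).
have [t0 t1] := conj (moment_ge0 d Ht) (moment_ge0 S Ht).
have q2 := moment_submul d d Hq; have t2 := moment_submul d d Ht.
have C2 : 0 <= C ^+ 2 by exact: sqr_ge0.
(* If [q S] is controlled by [t S], the Lipschitz bound and Cauchy-Schwarz suffice; otherwise the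
   sizes of [F q] and [F t] are bounded separately. *)
have [small|big] := leP (q S) (2 * t S + 1).
  apply: (@le_trans _ _ (C ^+ 2 * (1 + q d + t d) ^+ 2 * seq_dist d q t ^+ 2)).
    rewrite -[leLHS]real_normK ?num_real // -!exprMn ler_sqr ?nnegrE //.
    by rewrite mulr_ge0 ?seq_dist_ge0 // mulr_ge0 //; lra.
  have -> : C ^+ 2 * (60 + 9 * S%:R) * (1 + t S) * D2
    = C ^+ 2 * ((60 + 9 * S%:R) * (1 + t S) * D2) by ring.
  rewrite -[leLHS]mulrA ler_wpM2l //.
  apply: (@le_trans _ _ (9 * (1 + t S) * ((1 + S%:R) * D2))).
    apply: ler_pM; rewrite ?sqr_ge0 //.
    have := sqr_ge0 (1 - q d); have := sqr_ge0 (1 - t d).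
    have := sqr_ge0 (q d - t d); rewrite -/S in q2 t2; nra.
  have -> : 9 * (1 + t S) * ((1 + S%:R) * D2) = (9 + 9 * S%:R) * ((1 + t S) * D2) by ring.
  by rewrite -mulrA ler_wpM2r ?mulr_ge0 //; lra.
have dS : (q S - t S) ^+ 2 <= D2.
  by rewrite /D2 big_ord_recr /= lerDr sumr_ge0 // => k _; exact: sqr_ge0.
have bnd (x y : R) : `|x| <= C * (1 + y) -> x ^+ 2 <= C ^+ 2 * (2 * (1 + y ^+ 2)).
  move=> h; rewrite -[leLHS]real_normK ?num_real //.
  apply: (@le_trans _ _ ((C * (1 + y)) ^+ 2)).
    by rewrite ler_sqr ?nnegrE // (le_trans _ h).
  by rewrite exprMn ler_wpM2l //; have := sqr_ge0 (1 - y); nra.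
have F2 := bnd _ _ f1; have {f1 f2}F3 := bnd _ _ f3.
apply: (@le_trans _ _ (C ^+ 2 * (4 * (2 + q S + t S)))).
  rewrite -/S in q2 t2; have := sqr_ge0 (F q + F t).
  have : C ^+ 2 * (2 * (1 + q d ^+ 2)) <= C ^+ 2 * (2 * (1 + q S)).
    by rewrite ler_wpM2l //; nra.
  have : C ^+ 2 * (2 * (1 + t d ^+ 2)) <= C ^+ 2 * (2 * (1 + t S)).
    by rewrite ler_wpM2l //; nra.
  nra.
have -> : C ^+ 2 * (60 + 9 * S%:R) * (1 + t S) * D2
  = C ^+ 2 * ((60 + 9 * S%:R) * (1 + t S) * D2) by ring.
rewrite ler_wpM2l //.
apply: (@le_trans _ _ (60 * D2)); first by nra.
have : 0 <= S%:R * D2 by rewrite mulr_ge0.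
have : 0 <= t S * D2 by rewrite mulr_ge0.
have : 0 <= S%:R * (t S * D2) by rewrite !mulr_ge0.
nra.
Qed.

End MomentSequences.

(** * Uniform averages, variances and the Efron-Stein inequality *)

Section Averages.
Variable R : realFieldType.

Definition avg (T : finType) (f : T -> R) : R := #|T|%:R^-1 * \sum_x f x.
Definition var (T : finType) (f : T -> R) : R :=
  avg (fun x => f x ^+ 2) - avg f ^+ 2.

Section Basic.
Variable T : finType.
Implicit Types f g : T -> R.

Lemma avg_ext f g : f =1 g -> avg f = avg g.
Proof. by move=> fg; rewrite /avg; congr (_ * _); apply: eq_bigr. Qed.

Lemma avgD f g : avg (fun x => f x + g x) = avg f + avg g.
Proof. by rewrite /avg big_split mulrDr. Qed.

Lemma avgZ c f : avg (fun x => c * f x) = c * avg f.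
Proof. by rewrite /avg -mulr_sumr mulrCA. Qed.

Lemma avgB f g : avg (fun x => f x - g x) = avg f - avg g.
Proof. by rewrite /avg sumrB mulrBr. Qed.

Lemma avg_sum n (F : 'I_n -> T -> R) :
  avg (fun x => \sum_i F i x) = \sum_i avg (F i).
Proof. by rewrite /avg exchange_big mulr_sumr. Qed.

Lemma ler_avg f g : (forall x, f x <= g x) -> avg f <= avg g.
Proof.
by move=> fg; rewrite ler_wpM2l ?invr_ge0 ?ler0n //; apply: ler_sum.
Qed.

Lemma avg_cst c : (0 < #|T|)%N -> avg (fun _ : T => c) = c.
Proof.
move=> T0; rewrite /avg sumr_const -[c *+ _]mulr_natl mulKf //.
by rewrite pnatr_eq0 -lt0n.
Qed.

Lemma avg_sqr_sub f c : (0 < #|T|)%N ->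
  avg (fun x => (f x - c) ^+ 2) = var f + (avg f - c) ^+ 2.
Proof.
move=> T0; rewrite (@avg_ext _ (fun x => f x ^+ 2 - (2 * c * f x - c ^+ 2))).
  by rewrite avgB avgB avgZ avg_cst // /var; ring.
by move=> x; ring.
Qed.

Lemma var_le_avg f c : (0 < #|T|)%N -> var f <= avg (fun x => (f x - c) ^+ 2).
Proof. by move=> T0; rewrite avg_sqr_sub // lerDl sqr_ge0. Qed.

Lemma var_ge0 f : (0 < #|T|)%N -> 0 <= var f.
Proof.
move=> T0; have := avg_sqr_sub f (avg f) T0; rewrite subrr expr0n addr0 => <-.
by rewrite /avg mulr_ge0 ?invr_ge0 ?ler0n //; apply: sumr_ge0 => x _; rewrite sqr_ge0.
Qed.

End Basic.

Lemma avg_exchange (S T : finType) (F : S -> T -> R) :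
  avg (fun x => avg (F x)) = avg (fun y => avg (F ^~ y)).
Proof.
rewrite /avg -!mulr_sumr exchange_big mulrCA.
by congr (_ * (_ * _)).
Qed.

(** Convexity of the variance: for fixed x, Jensen's inequality in y applies to the deviations
    [h x y], centred separately for each y. *)
Lemma var_avg_le (S T : finType) (F : S -> T -> R) : (0 < #|S|)%N -> (0 < #|T|)%N ->
  var (fun x => avg (F x)) <= avg (fun y => var (F ^~ y)).
Proof.
move=> S0 T0; pose c := avg (fun x => avg (F x)).
have -> : var (fun x => avg (F x)) = avg (fun x => (avg (F x) - c) ^+ 2).
  by rewrite avg_sqr_sub // subrr expr0n addr0.
pose h x y := F x y - avg (F ^~ y).
apply: (@le_trans _ _ (avg (fun x => avg (fun y => h x y ^+ 2)))).
  apply: ler_avg => x; rewrite /c avg_exchange -avgB.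
  by have := var_ge0 (h x) T0; rewrite /var subr_ge0.
rewrite avg_exchange; apply: ler_avg => y.
by rewrite /h avg_sqr_sub // subrr expr0n addr0.
Qed.

Definition ffun_cons (T : finType) p (u : T * {ffun 'I_p -> T}) : {ffun 'I_p.+1 -> T} :=
  [ffun i => if unlift ord0 i is Some j then u.2 j else u.1].

Lemma ffun_cons_bij (T : finType) p : bijective (@ffun_cons T p).
Proof.
exists (fun s : {ffun 'I_p.+1 -> T} => (s ord0, [ffun j => s (lift ord0 j)])).
  move=> [x s]; congr (_, _); first by rewrite ffunE unlift_none.
  by apply/ffunP => j; rewrite !ffunE liftK.
move=> s; apply/ffunP => i; rewrite !ffunE /=.
by case: unliftP => [j ->|-> //]; rewrite ffunE.
Qed.

Lemma avg_ffunS (T : finType) p (F : {ffun 'I_p.+1 -> T} -> R) :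
  avg F = avg (fun x => avg (fun s => F (ffun_cons (x, s)))).
Proof.
rewrite /avg !card_ffun card_ord expnS natrM invfM -mulr_sumr mulrA.
congr (_ * _); first by rewrite card_ord.
rewrite (reindex (@ffun_cons T p)) /=; last first.
  exact/onW_bij/ffun_cons_bij.
by rewrite -(pair_bigA _ (fun x s => F (ffun_cons (x, s)))).
Qed.

Section SumOfSample.
Variables (V : zmodType) (T : finType) (P : T -> V).
Implicit Types Phi Psi : V -> R.

(** Only functions of the sum of the sample occur, so inductions on p can carry the sum N alone. *)
Definition Ex p Phi : R := avg (fun s : {ffun 'I_p -> T} => Phi (\sum_i P (s i))).
Definition VarEx p Phi : R := var (fun s : {ffun 'I_p -> T} => Phi (\sum_i P (s i))).

Lemma sum_ffun_cons p x (s : {ffun 'I_p -> T}) :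
  \sum_i P (ffun_cons (x, s) i) = \sum_i P (s i) + P x.
Proof.
rewrite big_ord_recl ffunE unlift_none /= addrC; congr (_ + _).
by apply: eq_bigr => i _; rewrite ffunE liftK.
Qed.

Lemma ExS p Phi : Ex p.+1 Phi = avg (fun x => Ex p (fun N => Phi (N + P x))).
Proof.
rewrite /Ex avg_ffunS; apply: avg_ext => x; apply: avg_ext => s.
by rewrite sum_ffun_cons.
Qed.

Lemma Ex_avg p (F : T -> V -> R) :
  avg (fun x => Ex p (F x)) = Ex p (fun N => avg (F ^~ N)).
Proof. exact: avg_exchange. Qed.

(** The invariant [G] holds for every sum that a sample can reach; it will be positive
    semidefiniteness. *)
Lemma Ex_le p (G : V -> Prop) Phi Psi :
  G 0 -> (forall N x, G N -> G (N + P x)) ->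
  (forall N, G N -> Phi N <= Psi N) -> Ex p Phi <= Ex p Psi.
Proof.
move=> G0 GS; elim: p Phi Psi => [|p IH] Phi Psi le.
  by apply: ler_avg => s; rewrite big_ord0; apply: le.
by rewrite !ExS; apply: ler_avg => x; apply: IH => N GN; apply: le; apply: GS.
Qed.

Lemma card_ffun_gt0 p : (0 < #|T|)%N -> (0 < #|{ffun 'I_p -> T}|)%N.
Proof. by move=> T0; rewrite card_ffun expn_gt0 T0. Qed.

(** Law of total variance, conditioning on the first sample point. *)
Lemma VarExS p Phi : VarEx p.+1 Phi =
  avg (fun x => VarEx p (fun N => Phi (N + P x)))
  + var (fun x => Ex p (fun N => Phi (N + P x))).
Proof.
rewrite /VarEx /var -/(Ex p.+1 Phi).
by rewrite -/(Ex p.+1 (fun N => Phi N ^+ 2)) !ExS avgB addrA subrK.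
Qed.

Lemma VarEx0 Phi : (0 < #|T|)%N -> VarEx 0 Phi = 0.
Proof.
move=> T0; apply/eqP; rewrite eq_le var_ge0 ?card_ffun_gt0 // andbT.
apply: le_trans (var_le_avg _ (Phi 0) (card_ffun_gt0 0 T0)) _.
rewrite -[leRHS](avg_cst 0 (card_ffun_gt0 0 T0)); apply: ler_avg => s.
by rewrite big_ord0 subrr expr0n.
Qed.

(* This is the Efron-Stein inequality for functions of the sum of the sample. *)
Lemma VarEx_le p Phi : (0 < #|T|)%N ->
  VarEx p.+1 Phi <= p.+1%:R * Ex p (fun N => var (fun x => Phi (N + P x))).
Proof.
move=> T0; elim: p Phi => [|p IH] Phi; rewrite VarExS -[_.+1%:R]natr1 mulrDl mul1r;
  (apply: lerD; last exact: var_avg_le T0 (card_ffun_gt0 _ T0)).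
  rewrite mul0r -[leRHS](avg_cst 0 T0).
  by apply: ler_avg => x; rewrite VarEx0.
rewrite ExS -avgZ; apply: ler_avg => x; apply: le_trans (IH _) _.
rewrite ler_wpM2l ?ler0n //; apply: ler_avg => s.
rewrite le_eqVlt; apply/orP; left; apply/eqP; congr (_ - _ ^+ 2);
  by apply: avg_ext => y; rewrite addrAC.
Qed.

End SumOfSample.
End Averages.

Lemma moment_avg (R : realFieldType) (T : finType) (q : T -> nat -> R) :
  (0 < #|T|)%N -> (forall x, moment_seq (q x)) ->
  moment_seq (fun k => avg (fun x => q x k)).
Proof.
move=> T0 Hq; split=> [|k u v].
  by rewrite -[RHS](avg_cst 1 T0); apply: avg_ext => x; case: (Hq x).
rewrite -!avgZ -!avgD -[leLHS](avg_cst 0 T0); apply: ler_avg => x.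
by case: (Hq x) => _; apply.
Qed.

(** * Positive semidefinite matrices and their quadratic forms *)

Section QuadraticForms.
Variables (C : numClosedFieldType) (n : nat).
Local Open Scope sesquilinear_scope.
Implicit Types (N A : 'M[C]_n) (u w : 'rV[C]_n).

Lemma adjM a b c (X : 'M[C]_(a, b)) (Y : 'M[C]_(b, c)) :
  (X *m Y)^t* = Y^t* *m X^t*.
Proof. by rewrite trmx_mul map_mxM. Qed.

Lemma mxtrace_mulC_adj_ge0 a b (X : 'M[C]_(a, b)) : 0 <= \tr (X *m X^t*).
Proof.
rewrite /mxtrace; apply: sumr_ge0 => i _; rewrite mxE; apply: sumr_ge0 => j _.
by rewrite !mxE mul_conjC_ge0.
Qed.

Definition outer u : 'M[C]_n := u^t* *m u.
Definition qform N u k : C := (u *m N ^+ k *m u^t*) 0 0.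
(** In this factorised form, adding [outer u] amounts to appending the row u to [V]. *)
Definition psdmx N : Prop := exists r (V : 'M[C]_(r, n)), N = V^t* *m V.

Lemma psdmx0 : psdmx 0.
Proof. by exists 0, 0; rewrite mulmx0. Qed.

Lemma psdmxD_outer N u : psdmx N -> psdmx (N + outer u).
Proof.
move=> [r [V ->]]; exists (r + 1)%N, (col_mx V u).
by rewrite tr_col_mx map_row_mx mul_row_col.
Qed.

Lemma psdmx_adj N : psdmx N -> N^t* = N.
Proof. by move=> [r [V ->]]; rewrite adjM trmxCK. Qed.

Lemma exprmx_adj N k : N^t* = N -> (N ^+ k)^t* = N ^+ k.
Proof.
move=> HN; elim: k => [|k IH]; first by rewrite !expr0 trmx1 map_mx1.
by rewrite [in LHS]exprS adjM IH HN exprSr.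
Qed.

Lemma qform_mxtrace N u k : qform N u k = \tr (u *m N ^+ k *m u^t*).
Proof. by rewrite /mxtrace big_ord1. Qed.

(** The form is the squared norm of u N^j for k = 2 j, and of u N^j V^* for k = 2 j + 1. *)
Lemma qform_ge0 N u k : psdmx N -> 0 <= qform N u k.
Proof.
move=> psdN; have HN := psdmx_adj psdN.
rewrite -[k]odd_double_half qform_mxtrace -addnn; move: k./2 => j.
have [r [V defN]] := psdN.
case: (odd k) => /=.
  suff -> : u *m N ^+ (1 + (j + j)) *m u^t* = (u *m N ^+ j *m V^t*) *m (u *m N ^+ j *m V^t*)^t*.
    exact: mxtrace_mulC_adj_ge0.
  rewrite !adjM trmxCK exprmx_adj // addnCA exprD exprS {2}defN.
  by rewrite -!mulmxE !mulmxA.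
rewrite add0n.
suff -> : u *m N ^+ (j + j) *m u^t* = (u *m N ^+ j) *m (u *m N ^+ j)^t*.
  exact: mxtrace_mulC_adj_ge0.
by rewrite !adjM exprmx_adj // exprD -!mulmxE !mulmxA.
Qed.

(** The expression is the k-th moment of N at the vector a u + b u N. *)
Lemma qform_hankel N u k (a b : C) : psdmx N -> a^* = a -> b^* = b ->
  0 <= a ^+ 2 * qform N u k + 2 * a * b * qform N u k.+1 + b ^+ 2 * qform N u k.+2.
Proof.
move=> psdN ra rb; have HN := psdmx_adj psdN.
suff -> : a ^+ 2 * qform N u k + 2 * a * b * qform N u k.+1 + b ^+ 2 * qform N u k.+2
   = qform N (a *: u + b *: (u *m N)) k by apply: qform_ge0.
rewrite !qform_mxtrace linearD !linearZ /= map_mxD !map_mxZ /= ra rb adjM HN.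
rewrite !(mulmxDl, mulmxDr) -!(scalemxAl, scalemxAr) !mxtraceD !mxtraceZ.
have -> : u *m N *m N ^+ k *m (N *m u^t*) = u *m N ^+ k.+2 *m u^t*.
  by rewrite exprSr exprS -!mulmxE !mulmxA.
have -> : u *m N *m N ^+ k *m u^t* = u *m N ^+ k.+1 *m u^t*.
  by rewrite exprS -!mulmxE !mulmxA.
have -> : u *m N ^+ k *m (N *m u^t*) = u *m N ^+ k.+1 *m u^t*.
  by rewrite exprSr -!mulmxE !mulmxA.
by ring.
Qed.

Lemma mxtrace_outer_mul u A : \tr (outer u *m A) = (u *m A *m u^t*) 0 0.
Proof. by rewrite /outer -mulmxA mxtrace_mulC /mxtrace big_ord1. Qed.

Lemma mxtrace_outer_sqr u w : \tr (outer u *m outer w) = `|hdot u w| ^+ 2.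
Proof.
rewrite mxtrace_outer_mul /outer mulmxA -mulmxA mxE big_ord1 normCK.
congr (_ * _); first by rewrite mxE; apply: eq_bigr => k _; rewrite !mxE.
rewrite mxE /hdot rmorph_sum; apply: eq_bigr => k _.
by rewrite !mxE rmorphM /= conjCK mulrC.
Qed.

(** Words in N and A are grouped by their rightmost letter A, which is followed by N^j. *)
Lemma exprmxD_expand N A l :
  (N + A) ^+ l = N ^+ l + \sum_(j < l) (N + A) ^+ (l.-1 - j) *m A *m N ^+ j.
Proof.
elim: l => [|l IH]; first by rewrite !expr0 big_ord0 addr0.
rewrite exprS IH mulrDr big_ord_recr /= subnn expr0 mulrDl -exprS -addrA; congr (_ + _).
rewrite addrC mul1mx -mulmxE; congr (_ + _).
rewrite mulmx_sumr; apply: eq_bigr => j _.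
have -> : (l - j = (l.-1 - j).+1)%N by have := ltn_ord j; lia.
by rewrite exprS -!mulmxE !mulmxA.
Qed.

End QuadraticForms.

(* With q k = u N^k u^* and M = N + u^* u, [rank1_word q k j] is u N^j M^k u^* and
   [rank1_diff q l] is tr M^l - tr N^l. *)
Fixpoint rank1_word (K : pzRingType) (q : nat -> K) k j : K :=
  if k is k'.+1 then rank1_word q k' j.+1 + q j * rank1_word q k' 0 else q j.
Definition rank1_diff (K : pzRingType) (q : nat -> K) l : K :=
  \sum_(j < l) rank1_word q (l.-1 - j) j.

(** Transfers the polynomial between real and complex moments. *)
Lemma rank1_diff_morph (K K' : pzRingType) (f : {rmorphism K -> K'}) (q : nat -> K) l :
  rank1_diff (f \o q) l = f (rank1_diff q l).
Proof.
have word k i : rank1_word (f \o q) k i = f (rank1_word q k i).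
  by elim: k i => [|k IH] i //=; rewrite !IH rmorphD rmorphM.
by rewrite /rank1_diff raddf_sum; apply: eq_bigr => j _; apply: word.
Qed.

Lemma eq_rank1_diff (K : pzRingType) (q q' : nat -> K) l :
  q =1 q' -> rank1_diff q l = rank1_diff q' l.
Proof.
move=> qq'; have word k i : rank1_word q k i = rank1_word q' k i.
  by elim: k i => [|k IH] i //=; rewrite !IH qq'.
by apply: eq_bigr.
Qed.

(** [rank1_word q k j] has weight k + j, so every summand of [rank1_diff] has weight (l - 1 - j) + j
    = l - 1. *)
Lemma tame_rank1_diff (R : realFieldType) l :
  tame l.-1 (fun q : nat -> R => rank1_diff q l).
Proof.
have word k j : tame (k + j) (fun q : nat -> R => rank1_word q k j).
  elim: k j => [|k IH] j /=; first exact: tame_coord.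
  apply: tameD; first by have := IH j.+1; rewrite addnS.
  have := tameM (tame_coord R j) (IH 0%N); apply: tame_leq; lia.
apply: tame_sum => j; have := word (l.-1 - j)%N j; rewrite subnK //.
by have := ltn_ord j; lia.
Qed.

(** * Traces of powers after a rank one update *)

Section RankOne.
Variables (C : numClosedFieldType) (n : nat).
Local Open Scope sesquilinear_scope.

(** In the leftmost factor N + u^* u, the term N raises j, while u^* u cuts the word into q_j and a
    shorter word with exponent 0. *)
Lemma rank1_wordE (N : 'M[C]_n) (u : 'rV[C]_n) k j :
  (u *m (N ^+ j *m (N + outer u) ^+ k) *m u^t*) 0 0 = rank1_word (qform N u) k j.
Proof.
elim: k j => [|k IH] j /=; first by rewrite expr0 mulmx1.
rewrite -!IH expr0 mul1mx exprS -mulmxE mulmxDl mulmxDr !mulmxDr mulmxDl mxE.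
congr (_ + _); first by rewrite exprSr -mulmxE !mulmxA.
rewrite /outer /qform !mulmxA -(mulmxA _ u) -mulmxA mxE big_ord1.
by rewrite (_ : ord0 = 0).
Qed.

Lemma mxtrace_rank1 (N : 'M[C]_n) (u : 'rV[C]_n) l :
  \tr ((N + outer u) ^+ l) = \tr (N ^+ l) + rank1_diff (qform N u) l.
Proof.
rewrite exprmxD_expand mxtraceD raddf_sum; congr (_ + _).
apply: eq_bigr => j _ /=; rewrite -mulmxA mxtrace_mulC -mulmxA mxtrace_outer_mul.
exact: rank1_wordE.
Qed.

End RankOne.

(** * Mutually unbiased bases and Bessel's inequality *)

Section Bessel.
Variables (C : numClosedFieldType) (n m : nat) (B : 'I_m -> 'I_n -> 'rV[C]_n).
Hypothesis (n0 : (0 < n)%N) (mubB : mutually_unbiased B).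
Local Open Scope sesquilinear_scope.
Let e (x : 'I_m * 'I_n) := B x.1 x.2.

(** A square matrix U with orthonormal rows also satisfies U^* U = 1. *)
Lemma sum_outer_basis i : \sum_a outer (B i a) = 1%:M.
Proof.
have [/(_ i) onB _] := mubB; pose U := \matrix_a B i a.
have : U *m U^t* = 1%:M.
  apply/matrixP => a b; rewrite !mxE -onB.
  by apply: eq_bigr => k _; rewrite !mxE.
move/mulmx1C => <-; apply/matrixP => a b; rewrite summxE mxE.
by apply: eq_bigr => k _; rewrite !mxE big_ord1 !mxE.
Qed.

Lemma sum_outer : \sum_x outer (e x) = m%:R%:M.
Proof.
rewrite -(pair_bigA _ (fun i a => outer (B i a))) /=.
under eq_bigr do rewrite sum_outer_basis.
by rewrite sumr_const card_ord raddfMn.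
Qed.

Lemma sum_qform N k : \sum_x qform N (e x) k = m%:R * \tr (N ^+ k).
Proof.
under eq_bigr do rewrite /qform -mxtrace_outer_mul.
by rewrite -raddf_sum -mulmx_suml sum_outer /= mul_scalar_mx mxtraceZ.
Qed.

Lemma overlap x y : \tr (outer (e x) *m outer (e y))
  = if x.1 == y.1 then (x.2 == y.2)%:R else n%:R^-1.
Proof.
case: mubB => onB mub; rewrite mxtrace_outer_sqr /e.
case: eqP => [->|/eqP xy]; first by rewrite onB; case: eqP; rewrite ?normr1 ?normr0 ?expr1n ?expr0n.
by rewrite mub // exprVn sqrtCK.
Qed.

(* The traceless parts of the projections attached to different bases are orthogonal. *)
Lemma bessel A : A^t* = A ->
  \sum_x ((e x *m A *m (e x)^t*) 0 0 - \tr A / n%:R) ^+ 2 <= \tr (A *m A).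
Proof.
move=> HA; pose d x := (e x *m A *m (e x)^t*) 0 0 - \tr A / n%:R; rewrite -/d.
have n1 : n%:R != 0 :> C by rewrite pnatr_eq0 -lt0n.
have real_tr : (\tr A)^* = \tr A.
  by rewrite -[in RHS]HA /mxtrace rmorph_sum; apply: eq_bigr => i _; rewrite !mxE.
have real_d x : (d x)^* = d x.
  rewrite /d rmorphB rmorphM fmorphV rmorph_nat /= real_tr; congr (_ - _).
  have {2}<- : (e x *m A *m (e x)^t*)^t* = e x *m A *m (e x)^t*.
    by rewrite !adjM trmxCK HA mulmxA.
  by rewrite [in RHS]mxE [in RHS]mxE.
have sum_d i : \sum_a d (i, a) = 0.
  rewrite /d sumrB sumr_const card_ord -[_ *+ n]mulr_natr mulfVK //.
  under eq_bigr do rewrite -mxtrace_outer_mul.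
  by rewrite -raddf_sum -mulmx_suml sum_outer_basis mul1mx subrr.
have sum_d_all : \sum_x d x = 0.
  rewrite (eq_bigr (fun x => d (x.1, x.2))) => [|[] //].
  by rewrite -(pair_bigA _ (fun i a => d (i, a))) /= big1.
(* [D] is the orthogonal projection of the traceless part of A onto the span of the traceless
   projections; the claim follows from 0 <= tr (A - D)^2 = tr A^2 - tr D^2. *)
pose D : 'M[C]_n := \sum_x d x *: outer (e x).
have HD : D^t* = D.
  rewrite /D raddf_sum raddf_sum; apply: eq_bigr => x _ /=.
  by rewrite linearZ /= map_mxZ /= real_d adjM trmxCK.
have trDA : \tr (D *m A) = \sum_x d x ^+ 2.
  rewrite /D mulmx_suml raddf_sum /=.
  transitivity (\sum_x (d x ^+ 2 + d x * (\tr A / n%:R))).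
    apply: eq_bigr => x _; rewrite -scalemxAl mxtraceZ mxtrace_outer_mul.
    by rewrite /d; ring.
  by rewrite big_split /= -mulr_suml sum_d_all mul0r addr0.
have trDD : \tr (D *m D) = \sum_x d x ^+ 2.
  rewrite {1}/D mulmx_suml raddf_sum /=; apply: eq_bigr => -[i a] _.
  rewrite -scalemxAl mxtraceZ expr2; congr (_ * _).
  rewrite /D mulmx_sumr raddf_sum /=.
  under eq_bigr do rewrite -scalemxAr mxtraceZ overlap.
  rewrite -(pair_bigA _ (fun j b => d (j, b) * (if i == j then (a == b)%:R else n%:R^-1))) /=.
  rewrite (bigD1 i) //= eqxx [X in _ + X]big1 ?addr0 => [|j ji].
    rewrite (bigD1 a) //= eqxx mulr1 big1 ?addr0 // => b ba.
    by rewrite eq_sym (negPf ba) mulr0.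
  (* Another basis contributes 1 / n times the sum of d over it, which vanishes. *)
  by rewrite eq_sym (negPf ji) -mulr_suml sum_d mul0r.
have := mxtrace_mulC_adj_ge0 (A - D).
have -> : (A - D)^t* = A - D by rewrite linearB /= map_mxB HA HD.
have trAD : \tr (A *m D) = \sum_x d x ^+ 2 by rewrite mxtrace_mulC.
have trB (X Y : 'M[C]_n) : \tr (X - Y) = \tr X - \tr Y by exact: raddfB.
by rewrite mulmxBl !mulmxBr !trB trAD trDA trDD subrr subr0 subr_ge0.
Qed.

End Bessel.

(** * Real-valued traces and moments *)

Section RealMoments.
Variables (R : realType) (n : nat).
Local Notation C := R[i].
Local Notation toC := (real_complex R).
Implicit Types (N : 'M[C]_n) (u : 'rV[C]_n).

Definition rtr N k : R := complex.Re (\tr (N ^+ k)).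
Definition rqform N u k : R := complex.Re (qform N u k).
(** For positive semidefinite N these are the moments of the normalised spectral distribution, and
    also the averages of [rqform] over the points of the bases. *)
Definition tau N k : R := rtr N k / n%:R.

Lemma conj_toC (a : R) : (toC a)^* = toC a.
Proof. by apply: conj_Creal; apply/complex_realP; exists a. Qed.

Lemma rqformE N u k : psdmx N -> toC (rqform N u k) = qform N u k.
Proof. by move=> psdN; rewrite RRe_real // ger0_real // qform_ge0. Qed.

Lemma moment_rqform N u : psdmx N -> hdot u u = 1 -> moment_seq (rqform N u).
Proof.
move=> psdN u1; split=> [|k a b].
  apply: (@complexI R); rewrite rqformE // rmorph1 -u1 /qform expr0 mulmx1 mxE.
  by apply: eq_bigr => i _; rewrite !mxE.
rewrite -lecR !(rmorphD, rmorphM, rmorphXn) /= !rqformE //.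
have := qform_hankel u k psdN (conj_toC a) (conj_toC b).
by rewrite -!expr2 rmorph0 rmorph1.
Qed.

Lemma rqform_rank1 N u l : psdmx N ->
  rtr (N + outer u) l = rtr N l + rank1_diff (rqform N u) l.
Proof.
move=> psdN; rewrite /rtr mxtrace_rank1.
have -> : rank1_diff (qform N u) l = toC (rank1_diff (rqform N u) l).
  rewrite -rank1_diff_morph; apply: eq_rank1_diff => k.
  by rewrite /= rqformE.
by case: (\tr _).
Qed.

End RealMoments.

Definition point_proj (C : numClosedFieldType) n m (B : 'I_m -> 'I_n -> 'rV[C]_n)
  (x : 'I_m * 'I_n) : 'M[C]_n := outer (B x.1 x.2).

(** * Moments averaged over the points of the bases *)

Section MubMoments.
Variables (R : realType) (n m : nat) (B : 'I_m -> 'I_n -> 'rV[R[i]]_n).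
Hypotheses (n0 : (0 < n)%N) (m0 : (0 < m)%N) (mubB : mutually_unbiased B).
Local Notation C := R[i].
Local Notation toC := (real_complex R).
Local Notation T := ('I_m * 'I_n)%type.
Implicit Types (N : 'M[C]_n) (x : T).
Let e x := B x.1 x.2.
Let P := point_proj B.

Lemma card_mub_gt0 : (0 < #|{: T}|)%N.
Proof. by rewrite card_prod !card_ord muln_gt0 m0. Qed.

Lemma rtrE N k : psdmx N -> toC (rtr N k) = \tr (N ^+ k).
Proof.
move=> psdN; rewrite RRe_real // ger0_real //.
have m1 : 0 < m%:R :> C by rewrite ltr0n.
rewrite -(pmulr_rge0 _ m1) -(sum_qform mubB).
by apply: sumr_ge0 => x _; apply: qform_ge0.
Qed.

Lemma moment_mub N x : psdmx N -> moment_seq (rqform N (e x)).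
Proof.
move=> psdN; apply: moment_rqform => //; case: mubB => onB _.
by rewrite onB eqxx.
Qed.

Lemma avg_rqform N k : psdmx N -> avg (fun x => rqform N (e x) k) = tau N k.
Proof.
move=> psdN; apply: (@complexI R).
rewrite /avg /tau rmorphM rmorphM rmorph_sum fmorphV fmorphV !rmorph_nat /= rtrE //.
under eq_bigr do rewrite rqformE //.
rewrite (sum_qform mubB) card_prod !card_ord natrM.
by field; rewrite !pnatr_eq0 -!lt0n n0.
Qed.

Lemma moment_tau N : psdmx N -> moment_seq (tau N).
Proof.
move=> psdN; have := moment_avg card_mub_gt0 (fun x => moment_mub x psdN).
by case=> q0 Hq; split=> [|k u v]; [have := q0|have := Hq k u v];
   rewrite !avg_rqform.
Qed.

(** Bessel's inequality for A = N^k, divided by the number m n of points; [tau] absorbs 1 / n and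
    the gain 1 / m remains. *)
Lemma avg_deviation_le N k : psdmx N ->
  avg (fun x => (rqform N (e x) k - tau N k) ^+ 2) <= tau N (k + k) / m%:R.
Proof.
move=> psdN; rewrite /avg card_prod !card_ord.
rewrite /tau -[leRHS]mulrA -invfM -natrM [leRHS]mulrC mulnC.
rewrite ler_wpM2l ?invr_ge0 ?ler0n // -lecR rtrE // exprD.
have := bessel n0 mubB (exprmx_adj k (psdmx_adj psdN)).
apply: le_trans; rewrite rmorph_sum le_eqVlt; apply/orP; left; apply/eqP.
apply: eq_bigr => x _; rewrite rmorphXn rmorphB rmorphM fmorphV rmorph_nat /=.
by rewrite rqformE // rtrE.
Qed.

Lemma psdmx_step N x : psdmx N -> psdmx (N + P x).
Proof. exact: psdmxD_outer. Qed.

Lemma Ex_psd_le p (Phi Psi : 'M[C]_n -> R) : (forall N, psdmx N -> Phi N <= Psi N) ->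
  Ex P p Phi <= Ex P p Psi.
Proof. exact: Ex_le (psdmx0 _ _) psdmx_step. Qed.

End MubMoments.

(** * Expected traces and the variance of trace powers *)

Section VarianceBound.
Variable R : realType.
Local Notation toC := (real_complex R).

(* Adding one sample point changes tr N^(k+1) by at most C (1 + q k), whose
   average over that point is C (1 + tau N k). *)
Lemma Ex_tau_step k (K : R) : 0 <= K -> exists2 K' : R, 0 <= K' &
  forall n m p (B : 'I_m -> 'I_n -> 'rV[R[i]]_n), (0 < n)%N -> (0 < m)%N ->
    mutually_unbiased B ->
    (forall p', (p' <= p)%N -> Ex (point_proj B) p' (fun N => tau N k) <= K) ->
    Ex (point_proj B) p (fun N => tau N k.+1) <= K' * (p%:R / n%:R).
Proof.
move=> K0; have [C C0 HC] := tame_rank1_diff R k.+1.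
exists (C * (1 + K)) => [|n m p B n0 m0 mubB]; first by rewrite mulr_ge0 ?addr_ge0.
have T0 := card_mub_gt0 n0 m0; set P := point_proj B.
have n1 : 0 < n%:R :> R by rewrite ltr0n.
elim: p => [|p IH] HK.
  (* The empty sample has sum 0, and the trace of 0^(k+1) vanishes because the exponent is
     positive. *)
  rewrite mul0r mulr0 /Ex -[leRHS](avg_cst 0 (card_ffun_gt0 0 T0)).
  by apply: ler_avg => s; rewrite big_ord0 /tau /rtr expr0n /= mxtrace0 mul0r.
have step N : psdmx N ->
    avg (fun x => tau (N + P x) k.+1) <= tau N k.+1 + C / n%:R * (1 + tau N k).
  move=> psdN; have Ht := moment_tau n0 m0 mubB psdN.
  rewrite -(avg_rqform n0 m0 mubB k psdN).
  rewrite -[X in X + _](avg_cst _ T0) -[X in _ * (X + _)](avg_cst _ T0) -avgD -avgZ -avgD.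
  apply: ler_avg => x; rewrite /tau rqform_rank1 // mulrDl lerD2l.
  rewrite mulrAC ler_wpM2r ?invr_ge0 ?ler0n //.
  have [+ _] := HC _ _ (moment_mub mubB x psdN) Ht.
  by apply: le_trans; rewrite ler_norm.
rewrite ExS Ex_avg.
apply: (@le_trans _ _ (Ex P p (fun N => tau N k.+1 + C / n%:R * (1 + tau N k)))).
  exact: Ex_psd_le step.
rewrite /Ex avgD avgZ avgD avg_cst ?card_ffun_gt0 //.
have -> : C * (1 + K) * (p.+1%:R / n%:R)
    = C * (1 + K) * (p%:R / n%:R) + C / n%:R * (1 + K).
  by rewrite -natr1; field; rewrite gt_eqF.
apply: lerD; first by apply: IH => p' /leqW; apply: HK.
by rewrite ler_wpM2l ?divr_ge0 ?ler0n // lerD2l; apply: (HK p).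
Qed.

Lemma Ex_tau_le k : exists2 K : R, 0 <= K &
  forall n m p (B : 'I_m -> 'I_n -> 'rV[R[i]]_n), (0 < n)%N -> (0 < m)%N ->
    mutually_unbiased B -> (p <= n)%N ->
    Ex (point_proj B) p (fun N => tau N k) <= K.
Proof.
elim: k => [|k [K K0 IH]].
  exists 1 => // n m p B n0 m0 mubB _.
  have T0 := card_mub_gt0 n0 m0.
  apply: (@le_trans _ _ (Ex (point_proj B) p (fun=> 1))); last first.
    by rewrite /Ex avg_cst ?card_ffun_gt0.
  by apply: Ex_psd_le => N /(moment_tau n0 m0 mubB)[->].
have [K' K'0 HK] := Ex_tau_step k K0; exists K' => // n m p B n0 m0 mubB pn.
apply: le_trans (HK n m p B n0 m0 mubB _) _ => [p' p'p|].
  by apply: IH => //; apply: leq_trans pn.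
by rewrite ler_piMr // ler_pdivrMr ?ltr0n // mul1r ler_nat.
Qed.

(** Retains the factor p / n: this p and the one from Efron-Stein will cancel the p^-2 in the
    variance of [A_l]. *)
Lemma Ex_tauS_le k : exists2 K : R, 0 <= K &
  forall n m p (B : 'I_m -> 'I_n -> 'rV[R[i]]_n), (0 < n)%N -> (0 < m)%N ->
    mutually_unbiased B -> (p <= n)%N ->
    Ex (point_proj B) p (fun N => tau N k.+1) <= K * (p%:R / n%:R).
Proof.
have [K K0 HK] := Ex_tau_le k; have [K' K'0 HK'] := Ex_tau_step k K0.
exists K' => // n m p B n0 m0 mubB pn; apply: HK' => // p' p'p.
by apply: HK => //; apply: leq_trans pn.
Qed.

Lemma Ex_tau_sum_le S l : exists2 K : R, 0 <= K &
  forall n m p (B : 'I_m -> 'I_n -> 'rV[R[i]]_n), (0 < n)%N -> (0 < m)%N ->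
    mutually_unbiased B -> (p <= n)%N ->
    Ex (point_proj B) p (fun N => \sum_(k < l) (tau N (k.+1 + k.+1) + tau N (S + (k.+1 + k.+1))))
      <= K * (p%:R / n%:R).
Proof.
elim: l => [|l [K K0 IH]].
  exists 0 => // n m p B n0 m0 _ _; rewrite mul0r.
  rewrite /Ex -[leRHS](avg_cst 0 (card_ffun_gt0 p (card_mub_gt0 n0 m0))).
  by apply: ler_avg => s; rewrite big_ord0.
have [K1 K10 H1] := Ex_tauS_le (l + l.+1); have [K2 K20 H2] := Ex_tauS_le (S + (l + l.+1)).
exists (K + (K1 + K2)) => [|n m p B n0 m0 mubB pn]; first by rewrite !addr_ge0.
rewrite !mulrDl; apply: le_trans _ (lerD (IH n m p B n0 m0 mubB pn)
  (lerD (H1 n m p B n0 m0 mubB pn) (H2 n m p B n0 m0 mubB pn))).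
rewrite /Ex -!avgD; apply: ler_avg => s.
by rewrite big_ord_recr /= (addSn l l.+1) (addnS S (l + l.+1)).
Qed.

Lemma var_rtr_step l : exists C S, 0 <= C /\
  forall n m (B : 'I_m -> 'I_n -> 'rV[R[i]]_n), (0 < n)%N -> (0 < m)%N ->
    mutually_unbiased B -> forall N, psdmx N ->
    var (fun x => rtr (N + point_proj B x) l) <=
      C / m%:R * \sum_(k < S) (tau N (k.+1 + k.+1) + tau N (S + (k.+1 + k.+1))).
Proof.
have [C [S [C0 HC]]] := tame_sqr_le (tame_rank1_diff R l).
exists C, S; split=> // n m B n0 m0 mubB N psdN.
have T0 := card_mub_gt0 n0 m0; have Ht := moment_tau n0 m0 mubB psdN.
have m1 : 0 < m%:R :> R by rewrite ltr0n.
(* The centre is the value predicted by the averaged moments [tau N]. *)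
apply: le_trans (var_le_avg _ (rtr N l + rank1_diff (tau N) l) T0) _.
pose q x := rqform N (B x.1 x.2).
apply: (@le_trans _ _ (C * (1 + tau N S) *
    \sum_(k < S.+1) avg (fun x => (q x k - tau N k) ^+ 2))).
  rewrite -avg_sum -avgZ; apply: ler_avg => x.
  rewrite rqform_rank1 // opprD addrACA subrr add0r.
  exact: HC (moment_mub mubB x psdN) Ht.
rewrite -!mulrA ler_wpM2l // big_ord_recl.
(* The index 0 drops out since both moments equal 1; only positive exponents remain, as [Ex_tauS_le]
   requires. *)
have -> : avg (fun x => (q x (@ord0 S) - tau N (@ord0 S)) ^+ 2) = 0.
  rewrite -[RHS](avg_cst 0 T0); apply: avg_ext => x.
  rewrite /q; have [-> _] := Ht; have [-> _] := moment_mub mubB x psdN.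
  by rewrite subrr expr0n.
rewrite add0r [_^-1 * _]mulrC mulr_suml mulr_sumr; apply: ler_sum => k _.
apply: (@le_trans _ _ ((1 + tau N S) * (tau N (k.+1 + k.+1) / m%:R))).
  rewrite ler_wpM2l ?addr_ge0 ?moment_ge0 //.
  exact: avg_deviation_le.
rewrite mulrA ler_wpM2r ?invr_ge0 ?ler0n // mulrDl mul1r lerD2l.
exact: moment_submul.
Qed.

(** Efron-Stein contributes p, the one-point variance 1 / m, and the expected normalised traces p /
    n. *)
Lemma VarEx_rtr_le l : exists2 K : R, 0 <= K &
  forall n m p (B : 'I_m -> 'I_n -> 'rV[R[i]]_n), (0 < n)%N -> (0 < m)%N ->
    mutually_unbiased B -> (p <= n)%N ->
    VarEx (point_proj B) p (fun N => rtr N l) <= K * (p%:R ^+ 2 / (m%:R * n%:R)).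
Proof.
have [C [S [C0 HC]]] := var_rtr_step l; have [K K0 HK] := Ex_tau_sum_le S S.
exists (C * K) => [|n m [|p] B n0 m0 mubB pn]; first exact: mulr_ge0.
  by rewrite VarEx0 ?card_mub_gt0 // expr0n mul0r mulr0.
have T0 := card_mub_gt0 n0 m0.
have [n1 m1] : n%:R != 0 :> R /\ m%:R != 0 :> R by rewrite !pnatr_eq0 -!lt0n.
apply: le_trans (VarEx_le _ _ _ T0) _.
apply: (@le_trans _ _ (p.+1%:R * (C / m%:R * (K * (p%:R / n%:R))))).
  rewrite ler_wpM2l ?ler0n //.
  apply: (@le_trans _ _ (Ex (point_proj B) p (fun N => C / m%:R *
      \sum_(k < S) (tau N (k.+1 + k.+1) + tau N (S + (k.+1 + k.+1)))))).
    by apply: Ex_psd_le => N psdN; apply: HC.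
  rewrite /Ex avgZ ler_wpM2l ?divr_ge0 ?ler0n //.
  by apply: HK => //; apply: ltnW.
have -> : C * K * (p.+1%:R ^+ 2 / (m%:R * n%:R)) =
  p.+1%:R * (C / m%:R * (K * (p.+1%:R / n%:R))) by field; rewrite n1 m1.
by rewrite !ler_wpM2l ?ler_wpM2r ?divr_ge0 ?invr_ge0 ?ler0n // ler_nat.
Qed.

End VarianceBound.

(** * From the Gram matrix to the sum of projections *)

Section GramMatrix.
Variables (R : realType) (n m p : nat) (B : 'I_m -> 'I_n -> 'rV[R[i]]_n).
Local Notation toC := (real_complex R).
Local Open Scope sesquilinear_scope.

(** Cyclicity of the trace for V V^* and V^* V; the exponent must be positive, as the two identity
    matrices have traces p and n. *)
Lemma mxtrace_gram l (s : Omega n m p) :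
  \tr (gram B s ^+ l.+1) = \tr ((\sum_i point_proj B (s i)) ^+ l.+1).
Proof.
pose V := \matrix_(i < p) B (s i).1 (s i).2.
have -> : gram B s = V *m V^t*.
  apply/matrixP => i j; rewrite !mxE; apply: eq_bigr => k _; by rewrite !mxE.
have -> : \sum_i point_proj B (s i) = V^t* *m V.
  apply/matrixP => a b; rewrite summxE mxE; apply: eq_bigr => k _.
  by rewrite /point_proj /outer !mxE big_ord1 !mxE.
have -> : (V *m V^t*) ^+ l.+1 = V *m (V^t* *m V) ^+ l *m V^t*.
  elim: l => [|l IH]; first by rewrite expr0 mulmx1.
  by rewrite exprS IH [in RHS]exprS -!mulmxE !mulmxA.
by rewrite -mulmxA mxtrace_mulC exprSr -mulmxE -mulmxA.
Qed.

Lemma Var_toC (X : Omega n m p -> R[i]) (f : Omega n m p -> R) :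
  (forall s, X s = toC (f s)) -> Var X = toC (var f).
Proof.
move=> Xf; have ExpE (Y : Omega n m p -> R[i]) g : (forall s, Y s = toC (g s)) ->
    Exp Y = toC (avg g).
  move=> Yg; rewrite /Exp /avg rmorphM fmorphV rmorph_nat rmorph_sum.
  by congr (_ * _); apply: eq_bigr.
have sqr_toC a : `|toC a| ^+ 2 = toC (a ^+ 2) by rewrite normCK conj_toC -rmorphM.
rewrite /Var (ExpE X f Xf) sqr_toC (ExpE _ (fun s => f s ^+ 2)) => [|s].
  by rewrite -rmorphB.
by rewrite Xf sqr_toC.
Qed.

End GramMatrix.

Theorem theorem3 (R : realType) (l : nat) (hl : (0 < l)%N) :
  exists K : R, forall (n m p : nat) (B : 'I_m -> 'I_n -> 'rV[R[i]]_n),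
    (2 <= n)%N -> (2 <= m)%N -> Num.sqrt (n%:R : R) <= m%:R ->
    mutually_unbiased B ->
    (0 < p)%N -> 0 < (p%:R / n%:R : R) < 1 ->
    `|Var (fun s : Omega n m p => A_l l B s)|
      <= (K%:C)%C * ((m%:R * n%:R)^-1 + (n%:R ^+ 2)^-1).
Proof.
case: l hl => // l _; have [K K0 HK] := VarEx_rtr_le R l.+1.
exists K => n m p B n2 m2 _ mubB p0 /andP[_ pn].
have [n0 m0] : (0 < n)%N /\ (0 < m)%N by split; apply: ltnW.
have {}pn : (p <= n)%N.
  by move: pn; rewrite ltr_pdivrMr ?ltr0n // mul1r ltr_nat => /ltnW.
have p1 : p%:R != 0 :> R by rewrite pnatr_eq0 -lt0n.
have [n1 m1] : 0 < n%:R :> R /\ 0 < m%:R :> R by rewrite !ltr0n.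
pose f (s : Omega n m p) := rtr (\sum_i point_proj B (s i)) l.+1.
have psd (s : Omega n m p) : psdmx (\sum_i point_proj B (s i)).
  by elim/big_rec: _ => [|i N _]; [exact: psdmx0|rewrite addrC; exact: psdmxD_outer].
rewrite (@Var_toC _ _ _ _ _ (fun s => p%:R^-1 * f s)) => [|s]; last first.
  rewrite /A_l mxtrace_gram -(rtrE m0 mubB) //.
  by rewrite rmorphM fmorphV rmorph_nat.
have -> : var (fun s => p%:R^-1 * f s) = (p%:R ^+ 2)^-1 * var f.
  rewrite /var avgZ exprMn -exprVn mulrBr; congr (_ - _).
  by rewrite -avgZ; apply: avg_ext => s; rewrite exprMn.
have V0 : 0 <= var f by apply: var_ge0; apply: card_ffun_gt0; exact: card_mub_gt0.
rewrite ger0_norm ?ler0c ?mulr_ge0 ?invr_ge0 ?sqr_ge0 //.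
have -> : (m%:R * n%:R)^-1 + (n%:R ^+ 2)^-1
    = (((m%:R * n%:R)^-1 + (n%:R ^+ 2)^-1 : R)%:C)%C :> R[i].
  by rewrite rmorphD !fmorphV rmorphM rmorphXn !rmorph_nat.
rewrite -rmorphM lecR.
(* The prefactor p^-2 cancels the p^2 of [VarEx_rtr_le]. *)
apply: (@le_trans _ _ (K * (m%:R * n%:R)^-1)).
  rewrite ler_pdivrMl ?exprn_gt0 ?lt_def ?p1 ?ler0n //.
  by apply: le_trans (HK n m p B n0 m0 mubB pn) _; rewrite mulrCA.
by rewrite ler_wpM2l // lerDl invr_ge0 sqr_ge0.
Qed.
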